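(* Let $S$ be a semidomain. Then the following statements are equivalent: (1) $S$ is a Dedekind semidomain. (2) Every nonzero integral ideal of $S$ is uniquely represented as a product of maximal ideals of $S$ (up to the order of the factors).
   Context: A semiring is $(S,+,\cdot,0,1)$ where $(S,+,0)$ and $(S,\cdot,1)$ are commutative monoids, $1\neq 0$, multiplication distributes over addition, and $a\cdot 0=0$ for all $a$. A semidomain is a semiring $S$ in which $ab=ac$ with $a\neq 0$ implies $b=c$. Its semifield of fractions $K=F(S)$ is the localization of $S$ at $S-\{0\}$. An (integral) ideal of $S$ is a nonempty subset of $S$ closed under addition and under multiplication by elements of $S$. A fractional ideal of $S$ is a nonempty subset $A\subseteq K$ closed under addition and under multiplication by elements of $S$ such that $dA\subseteq S$ for some nonzero $d\in S$. The product of fractional ideals $A,B$ is $AB=\{\sum_{i=1}^n a_ib_i: a_i\in A, b_i\in B\}$, and $A$ is invertible if $AB=S$ for some fractional ideal $B$. A Dedekind semidomain is a semidomain in which each nonzero fractional ideal is invertible. Products of ideals are finite products; the ideal $S$ itself is regarded as the empty product. *)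

(* Defs.v *)
From HB Require Import structures.
From mathcomp Require Import all_boot ssralg generic_quotient ring.
From mathcomp Require Import boolp classical_sets.

Set Implicit Arguments.
Unset Strict Implicit.
Unset Printing Implicit Defensive.

Import GRing.Theory.
Local Open Scope classical_set_scope.
Local Open Scope ring_scope.
Local Open Scope quotient_scope.

(* comNzSemiRingType already contains 1 != 0 and the absorption laws of 0. *)
HB.mixin Record ComNzSemiRing_isSemidomain S of GRing.ComNzSemiRing S := {
  semidomain_mulfI : forall a b c : S, a != 0 -> a * b = a * c -> b = c
}.

#[short(type="semidomainType")]
HB.structure Definition Semidomain :=
  {S of GRing.ComNzSemiRing S & ComNzSemiRing_isSemidomain S}.

Lemma semidomain_mulf_neq0 (S : semidomainType) (a b : S) :
  a != 0 -> b != 0 -> a * b != 0.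
Proof.
move=> a0; apply: contra => /eqP ab0; apply/eqP.
by apply: (@semidomain_mulfI S a) => //; rewrite mulr0.
Qed.

(* mathcomp's fraction.v needs an integral domain (in particular opposites),
   hence this variant of its construction for semidomains. *)
Module Semifrac.
Section Semifrac.
Variable S : semidomainType.

Inductive ratio := mkRatio { frac :> S * S; _ : frac.2 != 0 }.
HB.instance Definition _ := [isSub for frac].
HB.instance Definition _ := [Choice of ratio by <:].

Local Notation "'\n_' x" := (frac x).1 (at level 8, x at level 2).
Local Notation "'\d_' x" := (frac x).2 (at level 8, x at level 2).

Implicit Types x y z : ratio.

Lemma den_neq0 x : \d_x != 0. Proof. by case: x. Qed.

Lemma denM_neq0 x y : \d_x * \d_y != 0.
Proof. exact: semidomain_mulf_neq0 (den_neq0 x) (den_neq0 y). Qed.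

Definition equivf x y := \n_x * \d_y == \n_y * \d_x.

Lemma equivf_refl : reflexive equivf. Proof. by move=> x; apply/eqP. Qed.

Lemma equivf_sym : symmetric equivf.
Proof. by move=> x y; rewrite /equivf eq_sym. Qed.

Lemma equivf_trans : transitive equivf.
Proof.
move=> y x z /eqP xy /eqP yz; apply/eqP.
apply: (@semidomain_mulfI S _ _ _ (den_neq0 y)).
have -> : \d_y * (\n_x * \d_z) = (\n_x * \d_y) * \d_z by ring.
have -> : \d_y * (\n_z * \d_x) = (\n_z * \d_y) * \d_x by ring.
by rewrite xy -yz; ring.
Qed.

Canonical equivf_equiv := EquivRel equivf equivf_refl equivf_sym equivf_trans.

Definition type := {eq_quot equivf}.
HB.instance Definition _ : EqQuotient _ equivf type := EqQuotient.on type.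
HB.instance Definition _ := Choice.on type.

Lemma equivf_repr x :
  \n_(repr (\pi_type x)) * \d_x = \n_x * \d_(repr (\pi_type x)).
Proof.
have /eqmodP/eqP : repr (\pi_type x) = x %[mod type] by rewrite reprK.
by [].
Qed.

Definition ratio_of (s : S) : ratio := @mkRatio (s, 1) (oner_neq0 S).
Definition emb := lift_embed type ratio_of.
Canonical emb_pi_morph := PiEmbed emb.

Definition addf x y : ratio :=
  @mkRatio (\n_x * \d_y + \n_y * \d_x, \d_x * \d_y) (denM_neq0 x y).
Definition add := lift_op2 type addf.
Lemma pi_add : {morph \pi : x y / addf x y >-> add x y}.
Proof.
move=> x y; unlock add; apply/eqmodP/eqP => /=.
move: (equivf_repr x) (equivf_repr y).
set x' := repr _; set y' := repr _ => ex ey.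
rewrite [RHS]mulrDl.
have -> : \n_x' * \d_y' * (\d_x * \d_y) = (\n_x' * \d_x) * \d_y' * \d_y by ring.
have -> : \n_y' * \d_x' * (\d_x * \d_y) = (\n_y' * \d_y) * \d_x' * \d_x by ring.
by rewrite ex ey; ring.
Qed.
Canonical pi_add_morph := PiMorph2 pi_add.

Definition mulf x y : ratio :=
  @mkRatio (\n_x * \n_y, \d_x * \d_y) (denM_neq0 x y).
Definition mul := lift_op2 type mulf.
Lemma pi_mul : {morph \pi : x y / mulf x y >-> mul x y}.
Proof.
move=> x y; unlock mul; apply/eqmodP/eqP => /=.
move: (equivf_repr x) (equivf_repr y).
set x' := repr _; set y' := repr _ => ex ey.
by rewrite mulrACA -ex -ey mulrACA.
Qed.
Canonical pi_mul_morph := PiMorph2 pi_mul.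

Lemma addA : associative add.
Proof.
elim/quotW=> x; elim/quotW=> y; elim/quotW=> z; rewrite !piE.
by apply/eqmodP/eqP => /=; ring.
Qed.

Lemma addC : commutative add.
Proof.
elim/quotW=> x; elim/quotW=> y; rewrite !piE.
by apply/eqmodP/eqP => /=; ring.
Qed.

Lemma add0 : left_id (emb 0) add.
Proof.
elim/quotW=> x; rewrite !piE.
by apply/eqmodP/eqP => /=; ring.
Qed.

HB.instance Definition _ := GRing.isNmodule.Build type addA addC add0.

Lemma mulA : associative mul.
Proof.
elim/quotW=> x; elim/quotW=> y; elim/quotW=> z; rewrite !piE.
by apply/eqmodP/eqP => /=; ring.
Qed.

Lemma mulC : commutative mul.
Proof.
elim/quotW=> x; elim/quotW=> y; rewrite !piE.
by apply/eqmodP/eqP => /=; ring.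
Qed.

Lemma mul1 : left_id (emb 1) mul.
Proof.
elim/quotW=> x; rewrite !piE.
by apply/eqmodP/eqP => /=; ring.
Qed.

Lemma mulDl : left_distributive mul add.
Proof.
elim/quotW=> x; elim/quotW=> y; elim/quotW=> z; rewrite !piE.
by apply/eqmodP/eqP => /=; ring.
Qed.

Lemma mul0 : left_zero (emb 0) mul.
Proof.
elim/quotW=> x; rewrite !piE.
by apply/eqmodP/eqP => /=; ring.
Qed.

Lemma emb_inj : injective emb.
Proof.
move=> s t /eqP; rewrite piE => /eqP /=.
by rewrite !mulr1.
Qed.

Lemma nonzero1 : emb 1 != emb 0.
Proof. by rewrite (inj_eq emb_inj) oner_neq0. Qed.

HB.instance Definition _ := GRing.Nmodule_isComNzSemiRing.Build type
  mulA mulC mul1 mulDl mul0 nonzero1.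

Lemma embD : {morph emb : s t / s + t >-> add s t}.
Proof. by move=> s t; rewrite !piE; apply/eqmodP/eqP => /=; ring. Qed.

Lemma embM : {morph emb : s t / s * t >-> mul s t}.
Proof. by move=> s t; rewrite !piE; apply/eqmodP/eqP => /=; ring. Qed.

Lemma fracP (x : type) : exists s t : S, t != 0 /\ mul x (emb t) = emb s.
Proof.
elim/quotW: x => -[[s t] /= t0]; exists s, t; split=> //.
by rewrite !piE; apply/eqmodP/eqP => /=; ring.
Qed.

Lemma invP (x : type) : x != emb 0 -> exists y : type, mul y x = emb 1.
Proof.
elim/quotW: x => -[[s t] /= t0] x0.
have s0 : s != 0.
  apply: contra x0 => /eqP s0; rewrite piE.
  by apply/eqP => /=; rewrite s0; ring.
exists (\pi_type (@mkRatio (t, s) s0)).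
by rewrite !piE; apply/eqmodP/eqP => /=; ring.
Qed.

End Semifrac.
End Semifrac.
HB.export Semifrac.

Arguments Semifrac.type S%_type.
Notation "{ 'semifrac' S }" := (Semifrac.type S) (format "{ 'semifrac'  S }").

Definition tosemifrac (S : semidomainType) : S -> {semifrac S} :=
  @Semifrac.emb S.

Section SemifracTheory.
Variable S : semidomainType.
Local Notation emb := (@tosemifrac S).

Lemma tosemifrac_inj : injective emb. Proof. exact: Semifrac.emb_inj. Qed.

Lemma tosemifrac_is_nmod_morphism : nmod_morphism emb.
Proof. by split=> // s t; exact: Semifrac.embD. Qed.
HB.instance Definition _ :=
  GRing.isNmodMorphism.Build S {semifrac S} emb tosemifrac_is_nmod_morphism.

Lemma tosemifrac_is_monoid_morphism : monoid_morphism emb.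
Proof. by split=> // s t; exact: Semifrac.embM. Qed.
HB.instance Definition _ :=
  GRing.isMonoidMorphism.Build S {semifrac S} emb tosemifrac_is_monoid_morphism.

Lemma semifracP (x : {semifrac S}) :
  exists s t : S, t != 0 /\ x * emb t = emb s.
Proof. exact: Semifrac.fracP. Qed.

Lemma semifrac_inv (x : {semifrac S}) : x != 0 -> exists y, y * x = 1.
Proof. exact: Semifrac.invP. Qed.

End SemifracTheory.

Section Ideals.
Variable R : comNzSemiRingType.
Implicit Types A B I J M : set R.

Definition is_ideal I : Prop :=
  [/\ I !=set0,
      forall a b, I a -> I b -> I (a + b)
    & forall r a, I a -> I (r * a)].

Definition is_maximal_ideal M : Prop :=
  [/\ is_ideal M, M <> setT
    & forall J, is_ideal J -> M `<=` J -> J = M \/ J = setT].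

(* n = 0 only adds 0, which every (fractional) ideal product contains anyway. *)
Definition ideal_mul A B : set R :=
  [set x | exists (n : nat) (a b : 'I_n -> R),
     [/\ forall i, A (a i), forall i, B (b i) & x = \sum_(i < n) a i * b i]].

(* The empty product is the unit ideal setT. *)
Definition ideal_prod (s : seq (set R)) : set R := foldr ideal_mul setT s.

End Ideals.

Definition is_fractional_ideal (S : semidomainType) (A : set {semifrac S}) :=
  [/\ A !=set0,
      forall x y, A x -> A y -> A (x + y),
      forall (s : S) x, A x -> A (tosemifrac s * x)
    & exists2 d : S, d != 0
        & [set tosemifrac d * x | x in A] `<=` range (@tosemifrac S)].

(* range (@tosemifrac S) is S viewed inside its semifield of fractions. *)
Definition is_invertible (S : semidomainType) (A : set {semifrac S}) :=
  exists2 B : set {semifrac S},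
    is_fractional_ideal B & ideal_mul A B = range (@tosemifrac S).

Definition is_dedekind (S : semidomainType) :=
  forall A : set {semifrac S},
    is_fractional_ideal A -> A <> [set 0] -> is_invertible A.

(* Main.v *)
(** Clearing denominators, a semidomain is Dedekind iff every nonzero integral
    ideal [I] has an ideal [J] with [I J] nonzero principal.  Such ideals are
    cancellable and finitely generated, and [I `<=` M] makes [M] a factor of
    [I] with a strictly larger cofactor; the ascending chain condition then
    yields factorizations into maximal ideals, and primality of maximal ideals
    with cancellation yields their uniqueness.  Conversely, a nonzero element
    of a maximal ideal [M] generates an ideal of which [M] must be a factor, so
    [M], and hence every product of maximal ideals, divides a nonzero principal
    ideal. *)
Require Import Defs.
From mathcomp Require Import all_boot ssralg boolp classical_sets.
From mathcomp Require Import ring.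
Import GRing.Theory.
Local Open Scope classical_set_scope.
Local Open Scope ring_scope.

Set Implicit Arguments.
Unset Strict Implicit.
Unset Printing Implicit Defensive.

(** * Products of ideals in a commutative semiring *)

Section IdealTheory.
Variable R : comNzSemiRingType.
Implicit Types (d : R) (A B C I J M N : set R) (s t : seq (set R)).

(** Induction principle for products: it hides the finite sums, so later inclusions are checked on
    the generators [a * b] only. *)
Lemma ideal_mul_sub A B (P : set R) : P 0 ->
    (forall x y, P x -> P y -> P (x + y)) ->
    (forall a b, A a -> B b -> P (a * b)) ->
  ideal_mul A B `<=` P.
Proof.
move=> P0 PD PM _ [n [a [b [Aa Bb ->]]]].
by elim/big_ind: _ => // i _; exact: PM.
Qed.

Lemma mem_ideal_mul A B a b : A a -> B b -> ideal_mul A B (a * b).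
Proof.
move=> Aa Bb; exists 1, (fun=> a), (fun=> b).
by split=> //; rewrite big_ord1.
Qed.

Lemma ideal_mul0 A B : ideal_mul A B 0.
Proof. by exists 0, (fun=> 0), (fun=> 0); split; [case|case|rewrite big_ord0]. Qed.

Lemma ideal_mulD A B x y :
  ideal_mul A B x -> ideal_mul A B y -> ideal_mul A B (x + y).
Proof.
move=> [m [a [b [Aa Bb ->]]]] [n [c [d [Ac Bd ->]]]].
(* [glue] concatenates two families, so that the two sums become one sum over ['I_(m + n)]. *)
pose glue (f : 'I_m -> R) (g : 'I_n -> R) i :=
  match split i with inl j => f j | inr k => g k end.
exists (m + n)%N, (glue a c), (glue b d); split.
- by move=> i; rewrite /glue; case: split.
- by move=> i; rewrite /glue; case: split.
rewrite big_split_ord /=; congr (_ + _); apply: eq_bigr => i _.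
  by rewrite /glue (unsplitK (inl i)).
by rewrite /glue (unsplitK (inr i)).
Qed.

Lemma ideal_mulSS A A' B B' :
  A `<=` A' -> B `<=` B' -> ideal_mul A B `<=` ideal_mul A' B'.
Proof.
move=> AA BB; apply: ideal_mul_sub => [|x y|a b /AA ? /BB ?].
- exact: ideal_mul0.
- exact: ideal_mulD.
- exact: mem_ideal_mul.
Qed.

Lemma ideal_mulC A B : ideal_mul A B = ideal_mul B A.
Proof.
suff sub (X Y : set R) : ideal_mul X Y `<=` ideal_mul Y X.
  by apply/seteqP; split.
apply: ideal_mul_sub => [|x y|a b Xa Yb]; [exact: ideal_mul0|exact: ideal_mulD|].
by rewrite mulrC; exact: mem_ideal_mul.
Qed.

Lemma ideal_mulA A B C :
  ideal_mul A (ideal_mul B C) = ideal_mul (ideal_mul A B) C.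
Proof.
have sub (X Y Z : set R) : ideal_mul X (ideal_mul Y Z) `<=` ideal_mul (ideal_mul X Y) Z.
  apply: ideal_mul_sub => [|x y|a b Xa]; [exact: ideal_mul0|exact: ideal_mulD|].
  move: b; apply: ideal_mul_sub => [|x y ax ay|b c Yb Zc].
  - by rewrite mulr0; exact: ideal_mul0.
  - by rewrite mulrDr; exact: ideal_mulD.
  - by rewrite mulrA; apply: mem_ideal_mul => //; exact: mem_ideal_mul.
apply/seteqP; split; first exact: sub.
(* The reverse inclusion is the same one for the reversed triple, read through commutativity. *)
have := sub C B A.
by rewrite (ideal_mulC C (ideal_mul B A)) (ideal_mulC (ideal_mul C B) A)
           (ideal_mulC B A) (ideal_mulC C B).
Qed.

Lemma ideal_mulCA A B C :
  ideal_mul A (ideal_mul B C) = ideal_mul B (ideal_mul A C).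
Proof. by rewrite !ideal_mulA (ideal_mulC A B). Qed.

Lemma ideal0 I : is_ideal I -> I 0.
Proof. by case=> -[x Ix] _ IM; rewrite -(mul0r x); exact: IM. Qed.

Lemma idealT : is_ideal (setT : set R).
Proof. by split=> //; exists 0. Qed.

Lemma ideal_mul_ideal A B : is_ideal B -> is_ideal (ideal_mul A B).
Proof.
move=> [_ _ BM]; split; [by exists 0; exact: ideal_mul0|exact: ideal_mulD|].
move=> r; apply: ideal_mul_sub => [|x y rx ry|a b Aa Bb].
- by rewrite mulr0; exact: ideal_mul0.
- by rewrite mulrDr; exact: ideal_mulD.
- by rewrite mulrCA; apply: mem_ideal_mul => //; exact: BM.
Qed.

Lemma ideal_prod_ideal s : is_ideal (ideal_prod s).
Proof. by elim: s => [|M s IHs]; [exact: idealT|exact: ideal_mul_ideal]. Qed.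

Lemma ideal_mul_subr A J : is_ideal J -> ideal_mul A J `<=` J.
Proof.
move=> iJ; have [_ JD JM] := iJ.
by apply: ideal_mul_sub => // [|a b _]; [exact: ideal0|exact: JM].
Qed.

Lemma ideal_mul_subl I B : is_ideal I -> ideal_mul I B `<=` I.
Proof. by rewrite ideal_mulC; exact: ideal_mul_subr. Qed.

Lemma ideal_mulT I : is_ideal I -> ideal_mul I setT = I.
Proof.
move=> iI; apply/seteqP; split; first exact: ideal_mul_subl.
by move=> x Ix; rewrite -(mulr1 x); exact: mem_ideal_mul.
Qed.

Lemma ideal_neq0P I : is_ideal I -> I <> [set 0] <-> exists2 x, I x & x != 0.
Proof.
move=> iI; split=> [I0|[x Ix x0] I0]; last by move: Ix x0; rewrite I0 => ->; rewrite eqxx.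
apply: contrapT => nx; apply: I0; apply/seteqP; split=> [x Ix|_ ->]; last exact: ideal0.
by apply/eqP; apply: contrapT => /negP x0; apply: nx; exists x.
Qed.

Lemma principal_ideal d : is_ideal (range ( *%R d)).
Proof.
split; first by exists (d * 0), 0.
- by move=> _ _ [x _ <-] [y _ <-]; exists (x + y) => //; rewrite mulrDr.
- by move=> r _ [x _ <-]; exists (r * x) => //; rewrite mulrCA.
Qed.

Lemma principal_mul d J : is_ideal J ->
  ideal_mul (range ( *%R d)) J = [set d * x | x in J].
Proof.
move=> iJ; have [_ JD JM] := iJ; apply/seteqP; split; last first.
  move=> _ [x Jx <-]; apply: mem_ideal_mul => //.
  by exists 1 => //; rewrite mulr1.
apply: ideal_mul_sub.
- by exists 0; rewrite ?mulr0 //; exact: ideal0.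
- by move=> _ _ [x Jx <-] [y Jy <-]; exists (x + y); rewrite ?mulrDr //; exact: JD.
- by move=> _ b [x _ <-] Jb; exists (x * b); rewrite ?mulrA //; exact: JM.
Qed.

(** The colon ideal [(J : d)], which serves below to divide an ideal by [d]. *)
Lemma ideal_colon d J : is_ideal J -> is_ideal [set x | J (d * x)].
Proof.
move=> iJ; have [_ JD JM] := iJ; split.
- by exists 0; rewrite /= mulr0; exact: ideal0.
- by move=> x y /= Jx Jy; rewrite mulrDr; exact: JD.
- by move=> r x /= Jx; rewrite mulrCA; exact: JM.
Qed.

(** * Primality of maximal ideals *)

Lemma maximal_ideal_prime M I J : is_maximal_ideal M -> is_ideal J ->
  ideal_mul I J `<=` M -> I `<=` M \/ J `<=` M.
Proof.
move=> [iM MT Mmax] iJ IJM; have [//|] := pselect (I `<=` M); first by left.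
move=> /existsNP[a /not_implyP[Ia nMa]]; right=> b Jb.
have [_ MD MM] := iM.
(* [K] is the ideal [M + R a]; it is strictly larger than [M], hence contains 1. *)
pose K := [set y | exists2 m, M m & exists r, y = m + r * a].
have iK : is_ideal K.
  split.
  - by exists 0, 0; [exact: ideal0|exists 0; rewrite mul0r addr0].
  - move=> _ _ [m Mm [r ->]] [n Mn [q ->]]; exists (m + n); first exact: MD.
    by exists (r + q); rewrite mulrDl addrACA.
  - move=> r _ [m Mm [q ->]]; exists (r * m); first exact: MM.
    by exists (r * q); rewrite mulrDr mulrA.
have MK : M `<=` K by move=> m Mm; exists m => //; exists 0; rewrite mul0r addr0.
have Ka : K a by exists 0; [exact: ideal0|exists 1; rewrite mul1r add0r].
have [KM|KT] := Mmax _ iK MK; first by case: nMa; rewrite -KM.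
have [m Mm [r e1]] : K 1 by rewrite KT.
(* Here [b = m * b + r * (a * b)], where [m] lies in [M] and [a * b] in [ideal_mul I J]. *)
rewrite -(mul1r b) e1 mulrDl -mulrA; apply: MD; first by rewrite mulrC; exact: MM.
by apply: MM; apply: IJM; exact: mem_ideal_mul.
Qed.

Lemma maximal_sub_eq M N :
  is_maximal_ideal M -> is_maximal_ideal N -> N `<=` M -> N = M.
Proof. by move=> [iM MT _] [_ _ Nmax] /(Nmax _ iM)[]. Qed.

(** Primality puts some factor inside [M], and maximality of that factor makes it equal to [M]. The
    empty product is excluded because [M] is proper. *)
Lemma ideal_prod_sub_maximal M s : is_maximal_ideal M ->
    (forall N, N \in s -> is_maximal_ideal N) ->
  ideal_prod s `<=` M -> M \in s.
Proof.
move=> maxM; elim: s => [_ TM|N s IHs maxs].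
  by case: maxM => _ + _; case; apply/seteqP; split.
move=> /(maximal_ideal_prime maxM (ideal_prod_ideal s))[NM|sM]; rewrite inE.
  by rewrite (maximal_sub_eq maxM _ NM) ?eqxx//; apply: maxs; rewrite inE eqxx.
by rewrite IHs ?orbT// => L Ls; apply: maxs; rewrite inE Ls orbT.
Qed.

Lemma perm_ideal_prod_rem M s : M \in s ->
  ideal_prod s = ideal_mul M (ideal_prod (rem M s)).
Proof.
elim: s => //= N s IHs; rewrite inE; have [->//|NM /=] := eqVneq N M.
by move=> /IHs ->; rewrite ideal_mulCA.
Qed.

(** * Finite generation and the ascending chain condition *)

Definition finitely_generated I := exists2 g : seq R,
  (forall x, x \in g -> I x)
  & forall J, is_ideal J -> (forall x, x \in g -> J x) -> I `<=` J.

(** By induction on [g], keeping the larger of two comparable members of the chain. *)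
Lemma chain_seq (F : set (set R)) (g : seq R) : F !=set0 ->
    total_on F subset -> (forall x, x \in g -> (\bigcup_(X in F) X) x) ->
  exists2 X, F X & forall x, x \in g -> X x.
Proof.
move=> [X0 FX0] totF; elim: g => [|y g IHg] gF; first by exists X0.
have [|X FX gX] := IHg; first by move=> x xg; apply: gF; rewrite inE xg orbT.
have [Y FY Yy] := gF y (mem_head _ _).
have [XY|YX] := totF _ _ FX FY; [exists Y|exists X] => // x; rewrite inE.
  by case/predU1P => [->//|/gX/XY].
by case/predU1P => [->|/gX//]; exact: YX.
Qed.

(** Zorn's lemma: the union of a chain in [Q] is an ideal above a member of [Q], so it is finitely
    generated. One member of the chain contains all generators and is therefore the whole union.
    Finite generation is asked only above members of [Q], so that the zero ideal can be left out. *)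
Lemma noetherian_maximal (Q : set (set R)) : Q !=set0 ->
    (forall I, Q I -> is_ideal I) ->
    (forall I J, Q I -> is_ideal J -> I `<=` J -> finitely_generated J) ->
  exists2 I, Q I & forall J, Q J -> I `<=` J -> J = I.
Proof.
move=> [I0 QI0] Qid Qfg.
(* [Zorn_bigcup] also asks for the union of the empty chain. *)
have [F FP totF|I [PI Imax]] := @Zorn_bigcup _ (Q `|` [set set0]).
  have [[I FI [x Ix]]|none] := pselect (exists2 I, F I & I !=set0); last first.
    right; apply/seteqP; split=> // x [X FX Xx].
    by apply: none; exists X => //; exists x.
  have QF X y : F X -> X y -> Q X by move=> /FP[//|-> //].
  have QI : Q I by exact: QF Ix.
  have iU : is_ideal (\bigcup_(X in F) X).
    split; first by exists x, I.
    - move=> a b [X FX Xa] [Y FY Yb].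
      have [_ XD _] := Qid _ (QF _ _ FX Xa); have [_ YD _] := Qid _ (QF _ _ FY Yb).
      have [XY|YX] := totF _ _ FX FY; [exists Y|exists X] => //.
        by apply: YD => //; exact: XY.
      by apply: XD => //; exact: YX.
    - move=> r a [X FX Xa]; exists X => //.
      by have [_ _] := Qid _ (QF _ _ FX Xa); exact.
  have [g gU genU] := Qfg _ _ QI iU (bigcup_sup FI).
  (* Adding [x] to the generators ensures that [X] is not the empty set, hence lies in [Q]. *)
  have [|X FX gX] := @chain_seq F (x :: g) (ex_intro _ I FI) totF.
    by move=> y; rewrite inE => /predU1P[->|/gU//]; exists I.
  have QX : Q X by apply: (QF _ x) => //; apply: gX; exact: mem_head.
  suff -> : \bigcup_(X in F) X = X by left.
  apply/seteqP; split; last exact: bigcup_sup.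
  by apply: genU => [|y yg]; [exact: Qid|apply: gX; rewrite inE yg orbT].
(* The maximal set is not empty, since [I0] would be strictly larger. *)
have QI : Q I.
  case: PI => // I0'; have [[x I0x] _ _] := Qid _ QI0.
  case: (Imax I0); last by left.
  by rewrite I0'; split=> // /(_ x I0x).
exists I => // J QJ IJ; apply/seteqP; split=> //; apply: contrapT => nJI.
by apply: (Imax J); [split|left].
Qed.

End IdealTheory.

(** * Invertibility expressed inside the semidomain *)

Section QuasiInvertible.
Variable S : semidomainType.
Implicit Types (d : S) (I J M : set S) (s t : seq (set S)).

(** Invertibility without fractions: [J] stands for [d] times the inverse of [I]. *)
Definition quasi_invertible I := exists2 J, is_ideal J &
  exists2 d, d != 0 & ideal_mul I J = range ( *%R d).

Lemma principal_cancel d J J' : d != 0 -> is_ideal J -> is_ideal J' ->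
  ideal_mul (range ( *%R d)) J = ideal_mul (range ( *%R d)) J' -> J = J'.
Proof.
move=> d0 iJ iJ'; rewrite !principal_mul// => eqd.
have sub X Y : [set d * x | x in X] = [set d * x | x in Y] -> X `<=` Y.
  move=> XY x Xx; have : [set d * x | x in Y] (d * x) by rewrite -XY; exists x.
  by move=> [y Yy /(semidomain_mulfI _ _ _ d0) <-].
by apply/seteqP; split; exact: sub.
Qed.

(** Multiplying by the cofactor of [I] leaves a nonzero principal ideal, which cancels. *)
Lemma quasi_invertible_cancel I J J' : quasi_invertible I ->
  is_ideal J -> is_ideal J' -> ideal_mul I J = ideal_mul I J' -> J = J'.
Proof.
move=> [I' _ [d d0 II']] iJ iJ' /(congr1 (ideal_mul I')).
rewrite !ideal_mulA (ideal_mulC I') II'; exact: principal_cancel.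
Qed.

(** Write [d] as the sum of the [a i * b i]. For [x] in [I], each [x * b i] is some [d * c i], so
    [d * x] is [d] times the sum of the [c i * a i]; cancelling [d] shows that the [a i] generate
    [I]. *)
Lemma quasi_invertible_fg I :
  is_ideal I -> quasi_invertible I -> finitely_generated I.
Proof.
move=> iI [J iJ [d d0 IJ]].
have [n [a [b [Ia Jb dE]]]] : ideal_mul I J d by rewrite IJ; exists 1; rewrite ?mulr1.
exists (codom a) => [_ /codomP[i ->]//|K iK aK x Ix].
have [_ KD KM] := iK.
have /choice[c cE] i : exists c, d * c = x * b i.
  have : ideal_mul I J (x * b i) by exact: mem_ideal_mul.
  by rewrite IJ => -[c _ <-]; exists c.
have -> : x = \sum_i c i * a i.
  apply: (semidomain_mulfI _ _ _ d0); rewrite [in LHS]dE mulr_suml mulr_sumr.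
  by apply: eq_bigr => i _; rewrite mulrA cE; ring.
elim/big_ind: _ => //; first exact: ideal0.
by move=> i _; apply: KM; apply: aK; exact: codom_f.
Qed.

(** To contain is to divide. *)
Lemma quasi_invertible_dvd I M : quasi_invertible M -> is_ideal I ->
  I `<=` M -> exists2 L, is_ideal L & I = ideal_mul M L.
Proof.
move=> [M' iM' [d d0 MM']] iI IM.
(* [L] plays the role of [I] times the inverse of [M]. As [I M'] lies in [M M' = (d)], it equals
   [d L]; multiplying by [M] and cancelling [d] gives [I = M L]. *)
pose L := [set x | ideal_mul I M' (d * x)].
have iL : is_ideal L by exact/ideal_colon/ideal_mul_ideal.
have IM'L : ideal_mul I M' = ideal_mul (range ( *%R d)) L.
  rewrite principal_mul//; apply/seteqP; split=> [x IM'x|_ [x Lx <-]//].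
  have : ideal_mul M M' x by exact: ideal_mulSS IM'x.
  by rewrite MM' => -[y _ yx]; exists y => //; rewrite /L /= yx.
exists L => //; apply: (principal_cancel d0) => //; first exact: ideal_mul_ideal.
by rewrite ideal_mulCA -IM'L -MM' -ideal_mulA (ideal_mulC M').
Qed.

Lemma quasi_invertible_mul I J :
  quasi_invertible I -> quasi_invertible J -> quasi_invertible (ideal_mul I J).
Proof.
move=> [I' iI' [d d0 II']] [J' iJ' [e e0 JJ']].
exists (ideal_mul I' J'); first exact: ideal_mul_ideal.
exists (d * e); first exact: semidomain_mulf_neq0.
rewrite -ideal_mulA (ideal_mulCA J) ideal_mulA II' JJ'.
rewrite (principal_mul _ (principal_ideal e)) image_comp.
by congr image; apply/funext => x /=; rewrite mulrA.
Qed.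

Lemma quasi_invertibleT : quasi_invertible setT.
Proof.
exists setT; first exact: idealT.
exists 1; rewrite ?oner_neq0// ideal_mulT; last exact: idealT.
by apply/seteqP; split=> // x _; exists x; rewrite ?mul1r.
Qed.

(** If [B] inverts [I] and [e B] lies in [S], then [e B] is the required cofactor. Conversely, if
    [I = d A] is integral and [I J = (e)], then [(d / e) J] inverts [A]. *)
Lemma dedekindP : is_dedekind S <->
  forall I, is_ideal I -> I <> [set 0] -> quasi_invertible I.
Proof.
pose emb := @tosemifrac S.
have embM (s u : S) : emb (s * u) = emb s * emb u by exact: rmorphM.
have embD (s u : S) : emb (s + u) = emb s + emb u by exact: rmorphD.
have emb0 : emb 0 = 0 by exact: rmorph0.
have emb1 : emb 1 = 1 by exact: rmorph1.
have emb_sum n (F : 'I_n -> S) : emb (\sum_i F i) = \sum_i emb (F i).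
  exact: raddf_sum.
have emb_inj : injective emb by exact: tosemifrac_inj.
have emb_neq0 (s : S) : s != 0 -> emb s != 0 by rewrite -emb0 (inj_eq emb_inj).
have mulKI (s : S) (x y : {semifrac S}) : s != 0 -> emb s * x = emb s * y -> x = y.
  move=> /emb_neq0/semifrac_inv[z zs] /(congr1 ( *%R z)).
  by rewrite !mulrA zs !mul1r.
split=> [dedS I iI|qS A [A0 AD AM [d d0 dA]] An0].
  have [_ ID IM] := iI.
  move=> /(ideal_neq0P iI)[x0 Ix0 x0n0].
  have fA : is_fractional_ideal (emb @` I).
    split; first by exists (emb x0), x0.
    - by move=> _ _ [x Ix <-] [y Iy <-]; exists (x + y); rewrite ?embD//; exact: ID.
    - by move=> s _ [x Ix <-]; exists (s * x); rewrite ?embM//; exact: IM.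
    - exists 1; rewrite ?oner_neq0// => _ [_ [x _ <-] <-].
      by exists x => //; rewrite -/emb emb1 mul1r.
  have An0 : emb @` I <> [set 0].
    move=> A0; have : (emb @` I) (emb x0) by exists x0.
    by rewrite A0 => /eqP; rewrite (negPf (emb_neq0 _ x0n0)).
  have [B [[b0 Bb0] BD BM [e e0 eB]] AB] := dedS _ fA An0.
  exists [set s | exists2 b, B b & emb s = emb e * b].
    split.
    - have [s _ sE] : range emb (emb e * b0) by apply: eB; exists b0.
      by exists s, b0.
    - move=> s u [b Bb sE] [c Bc uE]; exists (b + c); first exact: BD.
      by rewrite embD sE uE mulrDr.
    - move=> r s [b Bb sE]; exists (emb r * b); first exact: BM.
      by rewrite embM sE mulrCA.
  exists e => //; apply/seteqP; split.
    apply: ideal_mul_sub; first by exists 0; rewrite ?mulr0.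
      by move=> _ _ [x _ <-] [y _ <-]; exists (x + y); rewrite ?mulrDr.
    move=> a s Ia [b Bb sE].
    have [c _ cE] : range emb (emb a * b).
      by rewrite -AB; apply: mem_ideal_mul => //; exists a.
    by exists c => //; apply: emb_inj; rewrite !embM sE cE mulrCA.
  (* With 1 the sum of the [a i * b i], [a i] the image of [f i] and [e * b i] that of [g i], the
     element [e * r] is the sum of the [r * f i * g i]. *)
  have [n [a [b [Aa Bb abE]]]] : ideal_mul (emb @` I) B (emb 1) by rewrite AB; exists 1.
  have /choice[f fP] i : exists u, I u /\ emb u = a i.
    by have [u Iu uE] := Aa i; exists u.
  have /choice[g gP] i : exists v, emb v = emb e * b i.
    by have [v _ vE] : range emb (emb e * b i); [apply: eB; exists (b i)|exists v].
  move=> _ [r _ <-]; exists n, (fun i => r * f i), g; split.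
  - by move=> i; apply: IM; case: (fP i).
  - by move=> i; exists (b i).
  apply: emb_inj; rewrite embM -[emb e]mulr1 -emb1 abE.
  rewrite emb_sum mulr_sumr mulr_suml; apply: eq_bigr => i _.
  by rewrite !embM gP (fP i).2; ring.
have A00 : A 0.
  by case: A0 => x Ax; rewrite -(mul0r x) -emb0; exact: AM.
pose I := [set s | exists2 a, A a & emb s = emb d * a].
have iI : is_ideal I.
  split; first by exists 0, 0; rewrite ?mulr0.
  - move=> s u [b Bb sE] [c Bc uE]; exists (b + c); first exact: AD.
    by rewrite embD sE uE mulrDr.
  - move=> r s [b Bb sE]; exists (emb r * b); first exact: AM.
    by rewrite embM sE mulrCA.
have In0 : I <> [set 0].
  move=> I0; apply: An0; apply/seteqP; split=> [x Ax|_ ->//].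
  have [s _ sE] : range emb (emb d * x) by apply: dA; exists x.
  have : I s by exists x.
  rewrite I0 => s0; apply: (mulKI _ _ _ d0).
  by rewrite -sE s0 emb0 mulr0.
have [J iJ [e e0 IJ]] := qS I iI In0.
have [_ JD JM] := iJ.
(* This is [(d / e) J], written without division. *)
pose B := [set x | exists2 j, J j & emb e * x = emb d * emb j].
exists B.
  split.
  - by exists 0, 0; [exact: ideal0|rewrite emb0 !mulr0].
  - move=> x y [j Jj xE] [k Jk yE]; exists (j + k); first exact: JD.
    by rewrite embD !mulrDr xE yE.
  - move=> s x [j Jj xE]; exists (s * j); first exact: JM.
    by rewrite embM mulrCA xE mulrCA.
  - exists e => // _ [x [j Jj xE] <-].
    by exists (d * j) => //; rewrite -/emb embM xE.
apply/seteqP; split.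
  apply: ideal_mul_sub; first by exists 0.
    by move=> _ _ [x _ <-] [y _ <-]; exists (x + y); rewrite -?embD.
  move=> a b Aa [j Jj bE].
  have [s _ sE] : range emb (emb d * a) by apply: dA; exists a.
  have : ideal_mul I J (s * j) by apply: mem_ideal_mul => //; exists a.
  rewrite IJ => -[t _ tE]; exists t => //; apply: (mulKI _ _ _ e0).
  by rewrite -embM tE embM sE mulrCA bE; ring.
(* Since [I J = e A B], applying this inclusion to [e * r] and cancelling [e] puts [r] in [A B]. *)
have lift : ideal_mul I J `<=`
    [set x | exists2 y, ideal_mul A B y & emb e * y = emb x].
  apply: ideal_mul_sub.
  - by exists 0; [exact: ideal_mul0|rewrite mulr0 emb0].
  - move=> x y [x' ABx xE] [y' ABy yE]; exists (x' + y'); first exact: ideal_mulD.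
    by rewrite mulrDr xE yE embD.
  - move=> s j [a Aa sE] Jj.
    (* [z] is [1 / e], so [z * (d * j)] is the element of [B] attached to [j]. *)
    have [z ze] := semifrac_inv (emb_neq0 _ e0).
    have zE : emb e * (z * (emb d * emb j)) = emb d * emb j.
      by rewrite mulrA (mulrC (emb e)) ze mul1r.
    exists (a * (z * (emb d * emb j))).
      by apply: mem_ideal_mul => //; exists j.
    by rewrite mulrCA zE embM sE; ring.
move=> _ [r _ <-].
have [|y ABy yE] := lift (e * r); first by rewrite IJ; exists r.
by rewrite -/emb -(mulKI _ _ _ e0 (etrans yE (embM e r))).
Qed.

(** * Unique factorization from quasi-invertibility *)

(** By induction on [s]: its head contains the product of [t], hence occurs in [t], and can be
    cancelled because a factor of a nonzero product is nonzero. *)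
Lemma maximal_prod_unique s t :
    (forall I, is_ideal I -> I <> [set 0] -> quasi_invertible I) ->
    (forall M, M \in s -> is_maximal_ideal M) ->
    (forall M, M \in t -> is_maximal_ideal M) ->
  ideal_prod s <> [set 0] -> ideal_prod s = ideal_prod t -> perm_eq s t.
Proof.
move=> qS; elim: s t => [|M s IHs] t maxs maxt.
  (* A nonempty [t] would make the unit ideal a subset of its proper head [N]. *)
  case: t maxt => // N t /(_ N (mem_head _ _))[iN NT _] _ /= TN.
  case: NT; apply/seteqP; split=> // x _.
  have : (setT : set S) x by [].
  by rewrite TN; exact: ideal_mul_subl.
move=> n0 st; have [iM MT Mmax] := maxs M (mem_head _ _).
have tM : M \in t.
  apply: ideal_prod_sub_maximal => //.
  by rewrite -st; exact: ideal_mul_subl.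
rewrite perm_sym (perm_trans (perm_to_rem tM))// perm_cons perm_sym.
have Mn0 : M <> [set 0].
  move=> M0; apply: n0; apply/seteqP; split=> [x /(ideal_mul_subl iM)|_ ->].
    by rewrite M0.
  exact: ideal_mul0.
apply: IHs => [N Ns|N /mem_rem|s0|]; [|exact: maxt| |].
- by apply: maxs; rewrite inE Ns orbT.
- apply: n0; apply/seteqP; split=> [x /= /(ideal_mul_subr (ideal_prod_ideal s))|_ ->].
    by rewrite s0.
  exact: ideal_mul0.
apply: (quasi_invertible_cancel (qS _ iM Mn0)); try exact: ideal_prod_ideal.
by rewrite -perm_ideal_prod_rem.
Qed.

Lemma maximal_prod_exists :
    (forall I, is_ideal I -> I <> [set 0] -> quasi_invertible I) ->
  forall I, is_ideal I -> I <> [set 0] -> exists2 s : seq (set S),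
    (forall M, M \in s -> is_maximal_ideal M) & I = ideal_prod s.
Proof.
move=> qS; pose nz I := is_ideal I /\ I <> [set 0].
have nzS I J : nz I -> is_ideal J -> I `<=` J -> nz J.
  move=> [iI /(ideal_neq0P iI)[x Ix x0]] iJ IJ; split=> //.
  by apply/(ideal_neq0P iJ); exists x => //; exact: IJ.
have fgS I J : nz I -> is_ideal J -> I `<=` J -> finitely_generated J.
  by move=> nzI iJ IJ; have [_ J0] := nzS _ _ nzI iJ IJ; exact/quasi_invertible_fg/qS.
move=> I iI In0; apply: contrapT => badI.
pose bad J := nz J /\ ~ exists2 s : seq (set S),
  (forall M, M \in s -> is_maximal_ideal M) & J = ideal_prod s.
(* [L] is maximal among the nonzero ideals without factorization. *)
have [|J [[]]//|J K [nzJ _]|L [nzL badL] Lmax] := @noetherian_maximal _ bad.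
- by exists I.
- exact: fgS.
have LT : L <> setT by move=> LT; apply: badL; exists [::].
have [iL Ln0] := nzL.
(* The same principle, applied to proper ideals above [L], gives a maximal ideal [M] containing
   [L]. *)
have [|J [[[]]]//|J K [[nzJ _] _]|M [[nzM LM] MT] Mmax] :=
  @noetherian_maximal _ [set J | (nz J /\ L `<=` J) /\ J <> setT].
- by exists L; split=> //; split.
- exact: fgS.
have [iM Mn0] := nzM.
have maxM : is_maximal_ideal M.
  split=> // J iJ MJ; have [->|JT] := pselect (J = setT); [by right|left].
  apply: Mmax => //; split=> //; split; first exact: nzS MJ.
  exact: subset_trans MJ.
have [K iK LMK] := quasi_invertible_dvd (qS _ iM Mn0) iL LM.
have LK : L `<=` K by rewrite LMK; exact: ideal_mul_subr.
have nzK : nz K by exact: nzS LK.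
have [[s smax KE]|badK] := pselect (exists2 s : seq (set S),
    (forall M, M \in s -> is_maximal_ideal M) & K = ideal_prod s).
  apply: badL; exists (M :: s); last by rewrite LMK KE.
  by move=> N; rewrite inE => /predU1P[->|/smax].
(* The cofactor [K] has no factorization, so it equals [L]; then [L M = L], and cancelling [L] makes
   [M] the unit ideal. *)
have KL : K = L by exact: Lmax.
apply: MT; apply: (quasi_invertible_cancel (qS _ iL Ln0)) => //; first exact: idealT.
by rewrite ideal_mulT// ideal_mulC -[in LHS]KL -LMK.
Qed.

(** * Quasi-invertibility from factorization *)

Lemma maximal_quasi_invertible :
    (forall I, is_ideal I -> I <> [set 0] -> exists2 s : seq (set S),
      (forall M, M \in s -> is_maximal_ideal M) & I = ideal_prod s) ->
  forall M, is_maximal_ideal M -> M <> [set 0] -> quasi_invertible M.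
Proof.
move=> factS M maxM; have [iM _ _] := maxM.
move=> /(ideal_neq0P iM)[a Ma a0].
have an0 : range ( *%R a) <> [set 0].
  apply/(ideal_neq0P (principal_ideal a)).
  by exists a => //; exists 1; rewrite ?mulr1.
have [s smax aE] := factS _ (principal_ideal a) an0.
have Ms : M \in s.
  apply: ideal_prod_sub_maximal => //; rewrite -aE => _ [r _ <-].
  by have [_ _ MM] := iM; rewrite mulrC; exact: MM.
exists (ideal_prod (rem M s)); first exact: ideal_prod_ideal.
by exists a => //; rewrite -perm_ideal_prod_rem.
Qed.

(** Nonzero products are required because in a semifield the zero ideal is maximal but not
    quasi-invertible. *)
Lemma maximal_prod_quasi_invertible :
    (forall M, is_maximal_ideal M -> M <> [set 0] -> quasi_invertible M) ->
  forall s, (forall M, M \in s -> is_maximal_ideal M) ->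
    ideal_prod s <> [set 0] -> quasi_invertible (ideal_prod s).
Proof.
move=> qmax; elim=> [|M s IHs] smax /= n0; first exact: quasi_invertibleT.
have maxM := smax M (mem_head _ _).
have [iM _ _] := maxM.
apply: quasi_invertible_mul.
  apply: qmax => // M0; apply: n0; apply/seteqP.
  split=> [x /(ideal_mul_subl iM)|_ ->]; [by rewrite M0|exact: ideal_mul0].
apply: IHs => [N Ns|s0]; first by apply: smax; rewrite inE Ns orbT.
apply: n0; apply/seteqP.
split=> [x /(ideal_mul_subr (ideal_prod_ideal s))|_ ->]; first by rewrite s0.
exact: ideal_mul0.
Qed.

End QuasiInvertible.

Theorem theorem3p28 (S : semidomainType) :
  is_dedekind S <->
  (forall I : set S, is_ideal I -> I <> [set 0] ->
     exists s : seq (set S),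
       [/\ (forall M, M \in s -> is_maximal_ideal M),
           I = ideal_prod s
         & forall t : seq (set S),
             (forall M, M \in t -> is_maximal_ideal M) ->
             I = ideal_prod t -> perm_eq s t]).
Proof.
rewrite dedekindP; split=> [qS I iI In0|factS I iI In0].
  have [s smax IE] := maximal_prod_exists qS iI In0.
  exists s; split=> // t tmax It.
  by apply: maximal_prod_unique; rewrite -?IE.
have [s [smax IE _]] := factS I iI In0.
rewrite IE; apply: maximal_prod_quasi_invertible => //; last by rewrite -IE.
apply: maximal_quasi_invertible => J iJ Jn0.
by have [t [tmax JE _]] := factS J iJ Jn0; exists t.
Qed.
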